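(* Any four-dimensional solvable subalgebra of $\mathfrak{sp}(4,\mathbb{C})$ containing no nonzero semisimple elements but which does not consist entirely of nilpotent elements must be conjugate to one of the following inequivalent algebras: $$\langle T_{1,1}+X_{\beta},X_{\alpha},X_{\alpha+\beta},X_{\alpha+2\beta}\rangle,\qquad \langle T_{1,0}+X_{\alpha},X_{\beta},X_{\alpha+\beta},X_{\alpha+2\beta}\rangle .$$
   Context: Let $J=\begin{pmatrix}0&0&1&0\\0&0&0&1\\-1&0&0&0\\0&-1&0&0\end{pmatrix}$. $\mathfrak{sp}(4,\mathbb{C})$ is the Lie algebra of $4\times4$ complex matrices $X$ with $JX^tJ=X$, and $Sp(4,\mathbb{C})=\{g\in GL(4,\mathbb{C}) : gJg^t=J\}$, acting on $\mathfrak{sp}(4,\mathbb{C})$ by conjugation $X\mapsto gXg^{-1}$. Elements are semisimple (nilpotent) if they are so as matrices. For $a,b\in\mathbb{C}$, $T_{a,b}=\mathrm{diag}(a,b,-a,-b)$. With $E_{ij}$ the matrix units, $X_\alpha=E_{24}$, $X_\beta=E_{12}-E_{43}$, $X_{\alpha+\beta}=E_{14}+E_{23}$, $X_{\alpha+2\beta}=E_{13}$. $\langle\,\cdot\,\rangle$ denotes the complex linear span. Two subalgebras are equivalent (conjugate) if some $g\in Sp(4,\mathbb{C})$ conjugates one onto the other. *)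

(* Defs.v *)
From HB Require Import structures.
From mathcomp Require Import all_boot all_order all_algebra.
From mathcomp Require Import complex reals.

Set Implicit Arguments.
Unset Strict Implicit.
Unset Printing Implicit Defensive.

Import GRing.Theory.
Local Open Scope ring_scope.

Definition sp4_J (F : fieldType) : 'M[F]_4 :=
  block_mx (0 : 'M_2) 1%:M (- 1%:M) (0 : 'M_2).

Definition in_sp4 (F : fieldType) (X : 'M[F]_4) : Prop :=
  sp4_J F *m X^T *m sp4_J F = X.

Definition in_Sp4 (F : fieldType) (g : 'M[F]_4) : Prop :=
  g \in unitmx /\ g *m sp4_J F *m g^T = sp4_J F.

Definition lie_bracket (F : fieldType) (X Y : 'M[F]_4) : 'M[F]_4 :=
  X *m Y - Y *m X.

Definition sp4_subalgebra (F : fieldType) (L : {vspace 'M[F]_4}) : Prop :=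
  (forall X, X \in L -> in_sp4 X) /\
  (forall X Y, X \in L -> Y \in L -> lie_bracket X Y \in L).

(* Brackets of basis vectors suffice, by bilinearity (as for prodv in
   falgebra): this is the span of all brackets of elements of L. *)
Definition derived_algebra (F : fieldType) (L : {vspace 'M[F]_4}) :
    {vspace 'M[F]_4} :=
  <<[seq lie_bracket X Y | X <- vbasis L, Y <- vbasis L]>>%VS.

Definition lie_solvable (F : fieldType) (L : {vspace 'M[F]_4}) : Prop :=
  exists n : nat, iter n (@derived_algebra F) L = 0%VS.

(* Over an algebraically closed field, semisimple means diagonalizable. *)
Definition semisimple_mx (C : numClosedFieldType) (X : 'M[C]_4) : Prop :=
  diagonalizable X.

Definition nilpotent_mx (F : fieldType) (X : 'M[F]_4) : Prop :=
  exists k : nat, X ^+ k = 0.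

Definition conj_lfun (F : fieldType) (g : 'M[F]_4) : 'End('M[F]_4) :=
  linfun (mulmxr (invmx g) \o mulmx g).

Definition Sp4_conjugate (F : fieldType) (L1 L2 : {vspace 'M[F]_4}) : Prop :=
  exists g : 'M[F]_4, in_Sp4 g /\ (conj_lfun g @: L1)%VS = L2.

(* Matrix units with rows and columns numbered from 1 to 4. *)
Definition matrix_unit (F : fieldType) (i j : nat) : 'M[F]_4 :=
  delta_mx (inord i.-1) (inord j.-1).

Definition torus_elt (F : fieldType) (a b : F) : 'M[F]_4 :=
  diag_mx (\row_j [:: a; b; - a; - b]`_j).

Definition X_alpha (F : fieldType) : 'M[F]_4 := matrix_unit F 2 4.
Definition X_beta (F : fieldType) : 'M[F]_4 := matrix_unit F 1 2 - matrix_unit F 4 3.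
Definition X_alpha_beta (F : fieldType) : 'M[F]_4 := matrix_unit F 1 4 + matrix_unit F 2 3.
Definition X_alpha_2beta (F : fieldType) : 'M[F]_4 := matrix_unit F 1 3.

Definition alg_T11 (F : fieldType) : {vspace 'M[F]_4} :=
  span [:: torus_elt 1 1 + X_beta F; X_alpha F; X_alpha_beta F; X_alpha_2beta F].

Definition alg_T10 (F : fieldType) : {vspace 'M[F]_4} :=
  span [:: torus_elt 1 0 + X_alpha F; X_beta F; X_alpha_beta F; X_alpha_2beta F].

(* Main.v *)
(* Lie's theorem is proved by induction on the derived length.  If K is an ideal
   of L acting on w by a weight lam and X is in L, then Y in K satisfies
   w p(X) Y = w (lam(Y) p + lam([X,Y]) p' + lower order)(X); for p of least degree
   killing w this forces lam([X,Y]) = 0 in characteristic 0, so the weight space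
   of K is L-stable.  For K = [L,L], taking traces shows that [L,L] kills its
   weight space, on which L is therefore a commuting family.  Applied to the
   natural representation and then to the induced 2-dimensional one on
   v^perp / v, this moves a solvable L into the Borel subalgebra spanned by the T_(a,b) and the
   four positive root vectors.

   An element of the Borel subalgebra whose torus part T_(a,b) is regular is
   diagonalizable, so L has a one-dimensional torus part, spanned by T_(a,b) say,
   and its nilpotent part has codimension 1 in the nilradical.  Closure under
   brackets forces X_(alpha+beta) and X_(alpha+2beta) into L, together with
   X_alpha, or X_beta, or (only if a = 3b, which is regular) some
   X_beta - k X_alpha with k <> 0.  In the first two cases the absence of
   semisimple elements gives a = b, respectively b = 0, and a torus element of
   Sp(4) normalizes the remaining coefficient. *)

Require Import Defs.
From mathcomp Require Import all_boot all_order all_algebra.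
From mathcomp Require Import complex reals boolp.
From mathcomp Require Import ring.

Import GRing.Theory Num.Theory.
Local Open Scope ring_scope.

Set Implicit Arguments.
Unset Strict Implicit.
Unset Printing Implicit Defensive.

(** * Weights of an ideal vanish on brackets, in characteristic 0 *)

Section WeightOfBracket.
Variables (C : numFieldType) (n : nat) (K : 'M[C]_n.+1 -> Prop).
Variables (lam : 'M[C]_n.+1 -> C) (X : 'M[C]_n.+1) (w : 'rV[C]_n.+1).
Hypothesis K_eigen : forall Y, K Y -> w *m Y = lam Y *: w.
Hypothesis K_ad : forall Y, K Y -> K (X *m Y - Y *m X).

Let orb (p : {poly C}) : 'rV[C]_n.+1 := w *m horner_mx X p.

Let orbD p q : orb (p + q) = orb p + orb q.
Proof. by rewrite /orb rmorphD mulmxDr. Qed.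

Let orbMX p : orb (p * 'X) = orb p *m X.
Proof. by rewrite /orb rmorphM /= horner_mx_X -mulmxE mulmxA. Qed.

Let orbC c : orb c%:P = c *: w.
Proof. by rewrite /orb horner_mx_C mul_mx_scalar. Qed.

(** Induction on p: moving Y past the last factor X leaves the commutator [X, Y], which is again in
    K, so the induction hypothesis is used for both Y and [X, Y]. *)
Lemma weight_horner (p : {poly C}) (Y : 'M[C]_n.+1) : K Y ->
  exists2 q : {poly C}, (size q <= (size p).-2)%N &
  w *m horner_mx X p *m Y =
  w *m horner_mx X (lam Y *: p + lam (X *m Y - Y *m X) *: p^`() + q).
Proof.
elim/poly_ind: p Y => [|p c IHp] Y KY.
  exists 0; first by rewrite size_poly0.
  by rewrite deriv0 !scaler0 !addr0 rmorph0 mulmx0 mul0mx.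
have [q sq eq_q] := IHp Y KY.
have [q' sq' eq_q'] := IHp _ (K_ad KY).
set mu := lam (X *m Y - Y *m X) in eq_q eq_q' *.
set mu' := lam _ in eq_q'.
have [->|p0] := eqVneq p 0.
  exists 0; first by rewrite size_poly0.
  rewrite mul0r add0r derivC scaler0 !addr0 -mul_polyC -polyCM -!/(orb _) !orbC.
  by rewrite -scalemxAl K_eigen // scalerA mulrC.
have spc : size (p * 'X + c%:P) = (size p).+1.
  by rewrite size_MXaddC (negPf p0).
(* Here mu' is the weight of [X, [X, Y]], coming from the induction hypothesis for [X, Y]. *)
exists (q * 'X + mu' *: p^`() + q').
  rewrite spc /=.
  apply: (leq_trans (size_polyD _ _)); rewrite geq_max; apply/andP; split.
    apply: (leq_trans (size_polyD _ _)); rewrite geq_max; apply/andP; split.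
      have [->|q0] := eqVneq q 0; first by rewrite mul0r size_poly0.
      rewrite size_mulX //; move: sq q0; rewrite -size_poly_eq0.
      by case: (size p) => [|[|s]] //=; case: (size q).
    apply: (leq_trans (size_scale_leq _ _)).
    by rewrite -ltnS prednK ?size_poly_gt0 // lt_size_deriv.
  by apply: leq_trans sq' _; apply: leq_pred.
have XY : X *m Y = Y *m X + (X *m Y - Y *m X) by rewrite addrC subrK.
rewrite -!/(orb _) in eq_q eq_q' *.
rewrite orbD orbMX orbC mulmxDl -mulmxA XY mulmxDr mulmxA eq_q eq_q'.
rewrite -scalemxAl K_eigen // scalerA -orbMX -orbC -!orbD.
congr (orb _); rewrite derivMXaddC -!mul_polyC polyCM; ring.
Qed.

Hypothesis w_neq0 : w != 0.

(** Descent on the size of a nonzero p with w p(X) = 0, starting from Cayley-Hamilton. If the weight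
    mu of [X, Y] were nonzero, mu p' + q would be a smaller nonzero polynomial of the same kind. *)
Lemma weight_bracket_eq0 (Y : 'M[C]_n.+1) : K Y -> lam (X *m Y - Y *m X) = 0.
Proof.
move=> KY.
have: orb (char_poly X) = 0 by rewrite /orb Cayley_Hamilton mulmx0.
have: char_poly X != 0 by rewrite monic_neq0 ?char_poly_monic.
have [d] := ubnP (size (char_poly X)).
elim: d (char_poly X) => // d IHd p; rewrite ltnS => sp p0 wp.
set mu := lam _; apply/eqP/negP => /negP mu0.
have [q sq eq_q] := weight_horner p KY; rewrite -!/(orb _) -/mu in eq_q.
set r := mu *: p^`() + q.
have wr : orb r = 0.
  move: eq_q; rewrite -addrA orbD -mul_polyC mulrC wp mul0mx.
  by rewrite /orb rmorphM /= -mulmxE mulmxA -/(orb _) wp mul0mx add0r.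
have sp1 : (1 < size p)%N.
  rewrite ltnNge; apply/negP => /size1_polyC pC.
  move: wp p0; rewrite pC orbC polyC_eq0 => /eqP.
  by rewrite scaler_eq0 (negPf w_neq0) orbF => ->.
(* The size bound on q is just enough for q not to reach the leading coefficient of p'. *)
have r_coef : r`_(size p).-2 = mu * (lead_coef p *+ (size p).-1).
  rewrite coefD coefZ coef_deriv (nth_default _ sq) addr0 lead_coefE.
  by case: (size p) sp1 => [|[|s]].
have r0 : r != 0.
  apply/negP => /eqP r0; move: r_coef; rewrite r0 coef0 => /esym/eqP.
  rewrite mulf_eq0 (negPf mu0) -mulr_natr mulf_eq0 lead_coef_eq0 (negPf p0) /=.
  by rewrite pnatr_eq0; case: (size p) sp1 => [|[|s]].
have sr : (size r < size p)%N.
  apply: (leq_ltn_trans (size_polyD _ _)); rewrite gtn_max; apply/andP; split.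
    exact: leq_ltn_trans (size_scale_leq _ _) (lt_size_deriv p0).
  by apply: leq_ltn_trans sq _; case: (size p) sp1 => [|[|s]].
by move/eqP: (IHd r (leq_trans sr sp) r0 wr); rewrite (negPf mu0).
Qed.

End WeightOfBracket.

(** * Lie's theorem *)

Section LieTheorem.
Variable C : numClosedFieldType.
Implicit Types L : {vspace 'M[C]_4}.

Lemma lie_bracket_sumE (I J : finType) (a : I -> C) (b : J -> C)
    (A : I -> 'M[C]_4) (B : J -> 'M[C]_4) :
  lie_bracket (\sum_i a i *: A i) (\sum_j b j *: B j) =
  \sum_i \sum_j (a i * b j) *: lie_bracket (A i) (B j).
Proof.
rewrite /lie_bracket mulmx_suml [X in _ - X]mulmx_sumr -sumrB.
apply: eq_bigr => i _; rewrite mulmx_sumr mulmx_suml -sumrB.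
apply: eq_bigr => j _.
by rewrite -!scalemxAl -!scalemxAr !scalerA scalerBr [b j * _]mulrC.
Qed.

Lemma mem_derived_algebra L X Y : X \in L -> Y \in L ->
  lie_bracket X Y \in derived_algebra L.
Proof.
move=> /coord_vbasis -> /coord_vbasis ->; rewrite lie_bracket_sumE.
apply: memv_suml => i _; apply: memv_suml => j _; apply: memvZ.
apply: memv_span; apply/allpairsP; exists ((vbasis L)`_i, (vbasis L)`_j).
by split=> //; apply: mem_nth; rewrite size_tuple.
Qed.

Lemma derived_algebra_sub L :
  (forall X Y, X \in L -> Y \in L -> lie_bracket X Y \in L) ->
  (derived_algebra L <= L)%VS.
Proof.
move=> L_lie; apply/span_subvP => _ /allpairsP[[X Y] [/= XL YL ->]].
by apply: L_lie; apply: vbasis_mem.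
Qed.

(** Compatibility with brackets is asked on L only, so that the action on v^perp / v can be given by
    a linear map on all matrices. *)
Theorem lie_eigenvector (m : nat) (rho : {linear 'M[C]_4 -> 'M[C]_m.+1}) L :
  (forall X Y, X \in L -> Y \in L -> lie_bracket X Y \in L) ->
  (forall X Y, X \in L -> Y \in L ->
     rho (lie_bracket X Y) = rho X *m rho Y - rho Y *m rho X) ->
  lie_solvable L ->
  exists2 w : 'rV[C]_m.+1, w != 0 & forall X, X \in L -> stablemx w (rho X).
Proof.
move=> L_lie rho_lie [d]; elim: d L L_lie rho_lie => [|d IHd] L L_lie rho_lie.
  move=> /= ->; exists (const_mx 1).
    by apply/negP => /eqP/rowP/(_ 0); rewrite !mxE => /eqP; rewrite oner_eq0.
  by move=> X; rewrite memv0 => /eqP ->; rewrite raddf0 stablemx0.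
rewrite iterSr; set D := derived_algebra L => D_solv.
have DL X : X \in D -> X \in L by apply/subvP/derived_algebra_sub.
have LD X Y : X \in L -> Y \in L -> lie_bracket X Y \in D.
  exact: mem_derived_algebra.
have [||w w0 wD] := IHd D _ _ D_solv.
- by move=> X Y /DL XL /DL; apply: LD.
- by move=> X Y /DL XL /DL; apply: rho_lie.
have [i wi0] : exists i, w 0 i != 0.
  apply/existsP; apply: contraNT w0; rewrite negb_exists => /forallP w_0.
  by apply/eqP/rowP => i; rewrite mxE; apply/eqP/negPn/w_0.
(* Reading the weight at a nonzero coordinate of w makes it linear on all matrices, so the weight
   space W below can be cut out by a basis of D. *)
pose lam (Z : 'M[C]_m.+1) := (w *m Z) 0 i / w 0 i.
have lam_w X : X \in D -> w *m rho X = lam (rho X) *: w.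
  move=> /wD /sub_rVP[a wa]; rewrite /lam wa mxE mulfK //.
pose W : 'M[C]_m.+1 :=
  (\bigcap_(j < \dim D)
      eigenspace (rho (vbasis D)`_j) (lam (rho (vbasis D)`_j)))%MS.
have lamE (c : 'I_(\dim D) -> C) (A : 'I_(\dim D) -> 'M[C]_m.+1) :
    lam (\sum_j c j *: A j) = \sum_j c j * lam (A j).
  rewrite /lam mulmx_sumr summxE mulr_suml; apply: eq_bigr => j _.
  by rewrite -scalemxAr mxE mulrA.
have inW k (u : 'M[C]_(k, m.+1)) :
    reflect (forall X, X \in D -> u *m rho X = lam (rho X) *: u) (u <= W)%MS.
  apply: (iffP sub_bigcapmxP) => [uW X XD | uW j _]; last first.
    by apply/eigenspaceP/uW/vbasis_mem/mem_nth; rewrite size_tuple.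
  rewrite (coord_vbasis XD) linear_sum mulmx_sumr.
  under [in RHS]eq_bigr do rewrite linearZ.
  rewrite lamE scaler_suml; apply: eq_bigr => j _.
  by rewrite linearZ -scalemxAr -scalerA; congr (_ *: _); apply/eigenspaceP/uW.
have wW : (w <= W)%MS by apply/inW.
(* Since XY = YX + [X, Y], stability needs the weight of [X, Y] to vanish; [weight_bracket_eq0]
   gives this, applied to u in W and K = rho(D). *)
have W_stable X : X \in L -> stablemx W (rho X).
  move=> XL; apply/rV_subP => _ /submxP[u ->]; rewrite mulmxA.
  have := submxMl u W; move: (u *m W) => {}u uW.
  have [->|u0] := eqVneq u 0; first by rewrite mul0mx sub0mx.
  apply/inW => Y YD; pose K Z := exists2 Y, Y \in D & Z = rho Y.
  have lam0 : lam (rho X *m rho Y - rho Y *m rho X) = 0.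
    apply: (@weight_bracket_eq0 _ _ K lam (rho X) u); last 2 first.
    - by [].
    - by exists Y.
    - by move=> _ [Z ZD ->]; apply/inW.
    - move=> _ [Z ZD ->]; exists (lie_bracket X Z); first exact/LD/DL.
      by rewrite rho_lie //; apply: DL.
  have XY : rho X *m rho Y = rho Y *m rho X + rho (lie_bracket X Y).
    by rewrite (rho_lie _ _ XL (DL _ YD)) addrC subrK.
  rewrite -mulmxA XY mulmxDr mulmxA (inW _ _ uW _ YD).
  rewrite (inW _ _ uW _ (LD _ _ XL (DL _ YD))) (rho_lie _ _ XL (DL _ YD)).
  by rewrite lam0 scale0r addr0 -scalemxAl.
have rW : (0 < \rank W)%N.
  by rewrite lt0n mxrank_eq0; apply: contraNneq w0 => W0; rewrite -submx0 -W0.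
(* On W the bracket acts as the scalar c and is a commutator of endomorphisms of W, so its trace c
   dim W is zero. *)
have lam0 X Y : X \in L -> Y \in L -> lam (rho (lie_bracket X Y)) = 0.
  move=> XL YL; set c := lam _.
  have Wc : conjmx (row_base W) (rho (lie_bracket X Y)) = c%:M.
    apply: conjmx_eigenvalue (row_base_free W); apply/eigenspaceP/inW/LD => //.
    by rewrite eq_row_base.
  have: \tr (c%:M : 'M_(\rank W)) = 0.
    rewrite -Wc rho_lie // /conjmx mulmxBr mulmxBl raddfB /= -!/(conjmx _ _).
    by rewrite !conjmxM ?inE ?stablemx_row_base ?W_stable // mxtrace_mulC subrr.
  rewrite mxtrace_scalar -mulr_natr => /eqP; rewrite mulf_eq0 pnatr_eq0.
  by rewrite eqn0Ngt rW orbF => /eqP.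
pose As := [seq conjmx (row_base W) (rho X) | X <- vbasis L].
have [A B /mapP[X /vbasis_mem XL ->] /mapP[Y /vbasis_mem YL ->]|v v0 /allP vAs] :=
  common_eigenvector (As := As) rW.
  rewrite /comm_mx -!conjmxM ?inE ?stablemx_row_base ?W_stable //.
  apply/eqP; rewrite -subr_eq0 /conjmx -mulmxBl -mulmxBr -rho_lie //.
  rewrite (inW _ (row_base W) _ _ (LD _ _ XL YL)) ?eq_row_base //.
  by rewrite lam0 // scale0r mul0mx.
exists (v *m row_base W); first by rewrite mulmx_free_eq0 ?row_base_free.
move=> X XL; rewrite (coord_vbasis XL) linear_sum mulmx_sumr.
apply: summx_sub => j _; rewrite linearZ -scalemxAr scalemx_sub //.
have Lj : (vbasis L)`_j \in vbasis L by apply: mem_nth; rewrite size_tuple.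
by rewrite -stablemx_restrict ?W_stable ?vbasis_mem // vAs //; apply: map_f.
Qed.

End LieTheorem.

(** * Entrywise computation with 4 x 4 matrices *)

Section Matrices4.
Variable F : fieldType.

(** Indexing by natural numbers lets a matrix identity compute down to sixteen scalar ones. *)
Definition mx4 (f : nat -> nat -> F) : 'M[F]_4 := \matrix_(i < 4, j < 4) f i j.

Definition tab (s : seq (seq F)) (i j : nat) : F := nth 0 (nth [::] s i) j.

Lemma eq_mx4 f g : (forall i j, (i < 4)%N -> (j < 4)%N -> f i j = g i j) <->
  mx4 f = mx4 g.
Proof.
split=> [fg|/matrixP fg i j i4 j4].
  by apply/matrixP => i j; rewrite !mxE fg.
by have := fg (Ordinal i4) (Ordinal j4); rewrite !mxE.
Qed.

Lemma mx4_eta (X : 'M[F]_4) : X = mx4 (fun i j => X (inord i) (inord j)).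
Proof. by apply/matrixP => i j; rewrite mxE !inord_val. Qed.

Lemma mx4D f g : mx4 f + mx4 g = mx4 (fun i j => f i j + g i j).
Proof. by apply/matrixP => i j; rewrite !mxE. Qed.

Lemma mx4N f : - mx4 f = mx4 (fun i j => - f i j).
Proof. by apply/matrixP => i j; rewrite !mxE. Qed.

Lemma mx4Z a f : a *: mx4 f = mx4 (fun i j => a * f i j).
Proof. by apply/matrixP => i j; rewrite !mxE. Qed.

Lemma mx4T f : (mx4 f)^T = mx4 (fun i j => f j i).
Proof. by apply/matrixP => i j; rewrite !mxE. Qed.

Lemma mx4M f g : mx4 f *m mx4 g =
  mx4 (fun i j => f i 0%N * g 0%N j + f i 1%N * g 1%N j +
             f i 2%N * g 2%N j + f i 3%N * g 3%N j).
Proof.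
apply/matrixP => i j; rewrite !mxE !big_ord_recl big_ord0 !mxE /=.
by rewrite addr0 !addrA.
Qed.

Lemma mx4C a : a%:M = mx4 (fun i j => a *+ (i == j)).
Proof. by apply/matrixP => i j; rewrite !mxE. Qed.

Lemma matrix_unitE i j : (0 < i <= 4)%N -> (0 < j <= 4)%N ->
  matrix_unit F i j = mx4 (fun k l => ((k.+1 == i) && (l.+1 == j))%:R).
Proof.
case: i j => [|i] [|j] //= i4 j4; apply/matrixP => k l.
by rewrite !mxE -!val_eqE /= !inordK.
Qed.

Lemma sp4_JE : sp4_J F = mx4 (tab [:: [:: 0; 0; 1; 0]; [:: 0; 0; 0; 1];
                                      [:: -1; 0; 0; 0]; [:: 0; -1; 0; 0]]).
Proof.
apply/matrixP => i j; rewrite !mxE.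
case: splitP => i' ei; rewrite !mxE; case: splitP => j' ej; rewrite !mxE ei ej;
by case: i' {ei} => [[|[|//]] ?];
   case: j' {ej} => [[|[|//]] ?]; rewrite /= ?oppr0.
Qed.

(* The parameters are the coordinates with respect to T_(1,0), T_(0,1), X_alpha,
   X_beta, X_(alpha+beta) and X_(alpha+2beta). *)
Definition borel (a b x y z t : F) : 'M[F]_4 :=
  mx4 (tab [:: [:: a; y; t; z]; [:: 0; b; z; x]; [:: 0; 0; - a; 0];
               [:: 0; 0; - y; - b]]).

End Matrices4.

Ltac mx4_entries :=
  apply/eq_mx4 => -[|[|[|[|//]]]] [|[|[|[|//]]]] _ _; rewrite /tab /=.

(** * The Borel subalgebra and sp(4) in coordinates *)

Section Borel.
Variable F : fieldType.
Implicit Types a b x y z t : F.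

Lemma torus_eltE a b : torus_elt a b = borel a b 0 0 0 0.
Proof.
apply/matrixP => -[[|[|[|[|//]]]] ?] -[[|[|[|[|//]]]] ?];
  by rewrite !mxE /tab /= ?mulr1n ?mulr0n ?oppr0.
Qed.

Lemma X_alphaE : X_alpha F = borel 0 0 1 0 0 0.
Proof. by rewrite /X_alpha matrix_unitE //; mx4_entries; rewrite ?oppr0. Qed.

Lemma X_betaE : X_beta F = borel 0 0 0 1 0 0.
Proof.
rewrite /X_beta !matrix_unitE // mx4N mx4D.
by mx4_entries; rewrite ?oppr0 ?addr0 ?add0r.
Qed.

Lemma X_alpha_betaE : X_alpha_beta F = borel 0 0 0 0 1 0.
Proof.
rewrite /X_alpha_beta !matrix_unitE // mx4D.
by mx4_entries; rewrite ?oppr0 ?addr0 ?add0r.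
Qed.

Lemma X_alpha_2betaE : X_alpha_2beta F = borel 0 0 0 0 0 1.
Proof.
by rewrite /X_alpha_2beta matrix_unitE //; mx4_entries; rewrite ?oppr0.
Qed.

Lemma borelD a b x y z t a' b' x' y' z' t' :
  borel a b x y z t + borel a' b' x' y' z' t' =
  borel (a + a') (b + b') (x + x') (y + y') (z + z') (t + t').
Proof. by rewrite mx4D; mx4_entries; ring. Qed.

Lemma borelZ c a b x y z t :
  c *: borel a b x y z t = borel (c * a) (c * b) (c * x) (c * y) (c * z) (c * t).
Proof. by rewrite mx4Z; mx4_entries; ring. Qed.

Lemma borel_bracket a b x y z t a' b' x' y' z' t' :
  lie_bracket (borel a b x y z t) (borel a' b' x' y' z' t') =
  borel 0 0 (2 * (b * x' - b' * x)) ((a - b) * y' - (a' - b') * y)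
    ((a + b) * z' - (a' + b') * z + x' * y - x * y')
    (2 * (a * t' - a' * t + y * z' - y' * z)).
Proof. by rewrite /lie_bracket !mx4M mx4N mx4D; mx4_entries; ring. Qed.

(** In the basis order 1, 2, 4, 3 the matrix is upper triangular with diagonal a, b, -b, -a, so this
    is its Cayley-Hamilton identity. *)
Lemma borel_char_poly a b x y z t : let X := borel a b x y z t in
  (X - a%:M) *m (X - b%:M) *m (X + b%:M) *m (X + a%:M) = 0.
Proof.
rewrite /= !mx4C !mx4N !mx4D !mx4M (_ : 0 = mx4 (fun _ _ => 0)).
  mx4_entries; ring.
by apply/matrixP => i j; rewrite !mxE.
Qed.

(** In 2 x 2 blocks: A, B over C, -A^T, with B and C symmetric. *)
Lemma sp4_mxE (X : 'M[F]_4) : in_sp4 X ->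
  exists a11 a12 a21 a22 b11 b12 b22 c11 c12 c22,
  X = mx4 (tab [:: [:: a11; a12; b11; b12]; [:: a21; a22; b12; b22];
                   [:: c11; c12; - a11; - a21]; [:: c12; c22; - a12; - a22]]).
Proof.
rewrite /in_sp4 (mx4_eta X); set f := fun i j => _.
rewrite sp4_JE mx4T !mx4M => /eq_mx4 fE.
exists (f 0 0)%N, (f 0 1)%N, (f 1 0)%N, (f 1 1)%N, (f 0 2)%N, (f 0 3)%N.
exists (f 1 3)%N, (f 2 0)%N, (f 2 1)%N, (f 3 1)%N; apply/eq_mx4 => i j i4 j4.
move: (fE i j i4 j4); rewrite /tab.
move: i j i4 j4 => [|[|[|[|//]]]] [|[|[|[|//]]]] _ _ //= <-; ring.
Qed.

End Borel.

Lemma invmx_mul (R : comUnitRingType) n (g h : 'M[R]_n) :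
  g \in unitmx -> h \in unitmx -> invmx (g *m h) = invmx h *m invmx g.
Proof.
move=> gu hu; have ghu : g *m h \in unitmx by rewrite unitmx_mul gu.
apply: (can_inj (mulKmx ghu)).
by rewrite mulmxV // !mulmxA mulmxK // mulmxV.
Qed.

(** * The symplectic group and its transitivity on nonzero vectors *)

Section Symplectic.
Variable F : fieldType.
Implicit Types g h X : 'M[F]_4.
Local Notation J := (sp4_J F).

Lemma sp4_J_sqr : J *m J = - 1%:M.
Proof. by rewrite sp4_JE mx4M mx4C mx4N; mx4_entries; ring. Qed.

(** Since J^2 = -1, the matrix -J g^T J is a right inverse of g. *)
Lemma in_Sp4I g : g *m J *m g^T = J -> in_Sp4 g.
Proof.
move=> gJ; split=> //; have /mulmx1_unit[] // : g *m (- (J *m g^T *m J)) = 1%:M.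
by rewrite mulmxN !mulmxA gJ sp4_J_sqr opprK.
Qed.

Lemma in_Sp4_mul g h : in_Sp4 g -> in_Sp4 h -> in_Sp4 (g *m h).
Proof.
move=> [_ gJ] [_ hJ]; apply: in_Sp4I.
by rewrite trmx_mul !mulmxA -2!(mulmxA g) hJ gJ.
Qed.

Lemma in_Sp4_mulJ g : in_Sp4 g -> g *m J = J *m (invmx g)^T.
Proof.
by move=> [gu gJ]; rewrite -{2}gJ -!mulmxA -trmx_mul mulVmx // trmx1 mulmx1.
Qed.

Lemma in_Sp4_trmulJ g : in_Sp4 g -> g^T *m J = J *m invmx g.
Proof.
move=> [gu gJ]; have: g *m (- (J *m g^T *m J)) = 1%:M.
  by rewrite mulmxN !mulmxA gJ sp4_J_sqr opprK.
move/mulmx1C => gK; rewrite -[g^T *m J](mulmxK gu); congr (_ *m _).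
rewrite -[RHS]mulmx1 -{}gK mulNmx mulmxN !mulmxA sp4_J_sqr.
by rewrite !mulNmx mul1mx opprK.
Qed.

Lemma in_sp4_conj g X : in_Sp4 g -> in_sp4 X -> in_sp4 (g *m X *m invmx g).
Proof.
move=> gSp XS; have [gu _] := gSp; rewrite /in_sp4 -{2}XS.
rewrite !trmx_mul !mulmxA -(in_Sp4_mulJ gSp) -!mulmxA.
by rewrite (in_Sp4_trmulJ gSp).
Qed.

(** The third row is the one to prescribe, as the third basis row vector is a left eigenvector of
    every Borel element. *)
Lemma Sp4_row3 (v : 'rV[F]_4) : v != 0 ->
  exists2 g, in_Sp4 g & row (inord 2) g = v.
Proof.
move=> v0; pose e k := v 0 (inord k).
have v_eta f :
    (forall j, (j < 4)%N -> f 2%N j = e j) -> row (inord 2) (mx4 f) = v.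
  move=> fv; apply/rowP => j; rewrite !mxE inordK // fv //.
  by rewrite /e inord_val.
suff [f [Jf fv]] : exists f, mx4 f *m J *m (mx4 f)^T = J /\
    forall j, (j < 4)%N -> f 2%N j = e j.
  by exists (mx4 f); [apply: in_Sp4I | apply: v_eta].
have [k k4 ek] : exists2 k, (k < 4)%N & e k != 0.
  have [k vk] : exists k, v 0 k != 0.
    apply/existsP; apply: contraNT v0; rewrite negb_exists => /forallP v_0.
    by apply/eqP/rowP => k; rewrite mxE; apply/eqP/negPn/v_0.
  by exists k => //; rewrite /e inord_val.
case: k k4 ek => [|[|[|[|//]]]] _ ek.
(* In each case the first row is scaled to pair to 1 with v, and the second and fourth are a
   hyperbolic pair corrected to be orthogonal to v. *)
- exists (tab [:: [:: 0; 0; - (e 0)^-1; 0]; [:: 0; 1; e 3 / e 0; 0];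
               [:: e 0; e 1; e 2; e 3]; [:: 0; 0; - (e 1 / e 0); 1]]).
  split; last by move=> [|[|[|[|//]]]] _.
  by rewrite sp4_JE mx4T !mx4M; mx4_entries; field.
- exists (tab [:: [:: 0; 0; 0; - (e 1)^-1]; [:: 1; 0; 0; e 2 / e 1];
               [:: e 0; e 1; e 2; e 3]; [:: 0; 0; 1; - (e 0 / e 1)]]).
  split; last by move=> [|[|[|[|//]]]] _.
  by rewrite sp4_JE mx4T !mx4M; mx4_entries; field.
- exists (tab [:: [:: (e 2)^-1; 0; 0; 0]; [:: - (e 3 / e 2); 1; 0; 0];
               [:: e 0; e 1; e 2; e 3]; [:: e 1 / e 2; 0; 0; 1]]).
  split; last by move=> [|[|[|[|//]]]] _.
  by rewrite sp4_JE mx4T !mx4M; mx4_entries; field.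
- exists (tab [:: [:: 0; (e 3)^-1; 0; 0]; [:: 1; - (e 2 / e 3); 0; 0];
               [:: e 0; e 1; e 2; e 3]; [:: 0; e 0 / e 3; 1; 0]]).
  split; last by move=> [|[|[|[|//]]]] _.
  by rewrite sp4_JE mx4T !mx4M; mx4_entries; field.
Qed.

End Symplectic.

(** * Conjugating a solvable subalgebra into the Borel subalgebra *)

Section Flag.
Variable C : numClosedFieldType.
Implicit Types L : {vspace 'M[C]_4}.

(** When v is the third basis row vector, the second and fourth ones span v^perp / v. *)
Let mid : 'I_2 -> 'I_4 := fun i => inord (i.*2.+1).

(** Acting on row vectors, the Borel subalgebra is the stabilizer in sp(4) of the flag spanned by
    e3, then by e3 and e4; g carries an L-stable isotropic flag to it. *)
Lemma in_borel_conj L : sp4_subalgebra L -> lie_solvable L ->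
  exists2 g, in_Sp4 g & forall X, X \in L ->
    exists a b x y z t, g *m X *m invmx g = borel a b x y z t.
Proof.
move=> [L_sp L_lie] L_solv.
have [|w w0 wL] := @lie_eigenvector C 3 idfun L L_lie _ L_solv.
  by move=> X Y.
have [g gSp gw] := Sp4_row3 w0; have [gu _] := gSp.
pose X1 X := g *m X *m invmx g.
have X1M X Y : X1 (X *m Y) = X1 X *m X1 Y.
  by rewrite /X1 !mulmxA mulmxKV.
have X1E X : X \in L -> exists a11 a12 a22 b11 b12 b22 c22,
    X1 X = mx4 (tab [:: [:: a11; a12; b11; b12]; [:: 0; a22; b12; b22];
                        [:: 0; 0; - a11; 0]; [:: 0; c22; - a12; - a22]]).
  move=> XL; have := in_sp4_conj gSp (L_sp X XL); rewrite -/(X1 X).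
  move=> /sp4_mxE[a11 [a12 [a21 [a22 [b11 [b12 [b22 [c11 [c12 [c22 XE]]]]]]]]]].
  have /sub_rVP[c wc] := wL X XL; move: wc => /= wc.
  have : row (inord 2) (X1 X) = c *: row (inord 2) 1%:M.
    by rewrite /X1 -mulmxA row_mul gw mulmxA wc -gw -scalemxAl -row_mul mulmxV.
  rewrite XE => /rowP r2; move: (r2 (inord 0)) (r2 (inord 1)) (r2 (inord 3)).
  rewrite !mxE !inordK // -!val_eqE /= !inordK //= /tab /= !mulr0.
  move=> c11_0 c12_0 /eqP; rewrite oppr_eq0 => /eqP a21_0.
  exists a11, a12, a22, b11, b12, b22, c22.
  by rewrite c11_0 c12_0 a21_0 oppr0.
have mid4 (i : 'I_2) : (i.*2.+1 < 4)%N by case: i => [[|[|//]] ?].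
pose rho : {linear 'M[C]_4 -> 'M[C]_2} :=
  mxsub mid mid \o (mulmxr (invmx g) \o mulmx g).
have rhoE X : rho X = mxsub mid mid (X1 X) by [].
(* The first column and third row vanish off the diagonal, so the middle block of a product has no
   cross terms. *)
have rhoM X Y : X \in L -> Y \in L -> rho (X *m Y) = rho X *m rho Y.
  move=> /X1E[? [? [? [? [? [? [? XE]]]]]]] /X1E[? [? [? [? [? [? [? YE]]]]]]].
  rewrite !rhoE X1M XE YE mx4M; apply/matrixP => i j.
  rewrite !mxE !big_ord_recl big_ord0 !mxE /mid /= !(inordK (mid4 _)).
  case: i => [[|[|//]] ?]; case: j => [[|[|//]] ?];
    rewrite /= ?inordK // /tab /=; ring.
have [X Y XL YL|u u0 uL] := @lie_eigenvector C 1 rho L L_lie _ L_solv.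
  have rhoB A B : rho (A - B) = rho A - rho B by exact: raddfB.
  by rewrite /lie_bracket rhoB !rhoM.
pose p := u 0 0; pose q := u 0 1.
(* Completes the eigenvector (p, q) to a matrix of determinant 1, which is symplectic in the block
   of coordinates 2 and 4. *)
have [k [l klpq]] : exists k l, k * q - l * p = 1.
  have [p0|p0] := eqVneq p 0; last first.
    by exists 0, (- p^-1); rewrite mul0r sub0r mulNr opprK mulVf.
  have q0 : q != 0.
    apply: contraNneq u0 => q0; apply/eqP/rowP => i; rewrite mxE.
    by case: i => [[|[|//]] ?]; [rewrite -p0 | rewrite -q0];
       congr (u 0 _); apply: val_inj.
  by exists q^-1, 0; rewrite mulVf // mul0r subr0.
pose h := mx4 (tab [:: [:: 1; 0; 0; 0]; [:: 0; k; 0; l];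
                       [:: 0; 0; 1; 0]; [:: 0; p; 0; q]]).
have hSp : in_Sp4 h.
  apply: in_Sp4I; rewrite sp4_JE mx4T !mx4M; mx4_entries;
    rewrite ?(mul0r, mulr0, mul1r, mulr1, add0r, addr0, mulrN, mulrN1, mulNr) //;
    rewrite -?klpq; ring.
have [hu _] := hSp.
exists (h *m g); first exact: in_Sp4_mul.
move=> X XL; pose Z := h *m X1 X *m invmx h.
have -> : h *m g *m X *m invmx (h *m g) = Z.
  by rewrite /Z /X1 invmx_mul // !mulmxA.
have Zh : Z *m h = h *m X1 X by rewrite mulmxKV.
have : in_sp4 Z by do 2!apply: in_sp4_conj => //; apply: L_sp.
move=> /sp4_mxE[a11 [a12 [a21 [a22 [b11 [b12 [b22 [c11 [c12 [c22 ZE]]]]]]]]]].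
have /sub_rVP[c] := uL X XL; rewrite rhoE.
have [d11 [d12 [d22 [e11 [e12 [e22 [f22 XE]]]]]]] := X1E X XL.
move: Zh; rewrite ZE XE !mx4M => /eq_mx4 Zh.
move=> /rowP uc; move: (uc 0) (uc 1).
rewrite !mxE !big_ord_recl !big_ord0 !mxE /= /mid /= !inordK //= /tab /=.
have -> : lift ord0 ord0 = 1 :> 'I_2 by apply: val_inj.
rewrite -/p -/q => uc0 uc1.
move: (Zh 2 0 isT isT)%N (Zh 2 1 isT isT)%N (Zh 2 3 isT isT)%N
  (Zh 3 1 isT isT)%N (Zh 3 3 isT isT)%N.
rewrite /tab /= !(mul0r, mulr0, mul1r, mulr1, add0r, addr0).
move=> z20 z21 z23 z31 z33.
(* [z21] and [z23] are two homogeneous linear equations in c12 and a21 with determinant kq - lp = 1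
   up to sign. *)
have c12_0 : c12 = 0.
  rewrite -[c12]mulr1 -klpq -[RHS](mul0r q) -z21 -[RHS]subr0 -[in RHS](mul0r p).
  by rewrite -z23; ring.
have a21_0 : a21 = 0.
  rewrite -[a21]mulr1 -klpq -[RHS](mul0r l) -z21 -[RHS]subr0 -[in RHS](mul0r k).
  by rewrite -z23; ring.
(* Here the eigenvector equation for (p, q) enters: eliminating a22 leaves c22 (kq - lp) = cpq -
   cqp. *)
have c22_0 : c22 = 0.
  move: uc0 uc1; rewrite !addr0 -z31 -z33 => uc0 uc1.
  rewrite -[c22]mulr1 -klpq -[RHS](subrr (c * p * q)) -{1}uc0.
  by rewrite mulrAC -uc1; ring.
exists a11, a22, b22, a12, b12, b11.
by rewrite z20 c12_0 a21_0 c22_0 oppr0.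
Qed.

End Flag.

(** * Conjugation, the torus, and membership in the two target algebras *)

Section Conjugation.
Variable F : fieldType.
Implicit Types (g X : 'M[F]_4) (L : {vspace 'M[F]_4}).

Lemma conj_lfunE g X : conj_lfun g X = g *m X *m invmx g.
Proof. by rewrite lfunE. Qed.

Lemma dim_conj_lfun g L : g \in unitmx -> \dim (conj_lfun g @: L) = \dim L.
Proof.
move=> gu; apply: limg_dim_eq; apply/eqP; rewrite -subv0.
apply/subvP => X; rewrite memv_cap memv_ker conj_lfunE => /andP[_ /eqP gX].
by rewrite memv0 -(mulKmx gu X) -(mulmxKV gu (g *m X)) gX mul0mx mulmx0.
Qed.

Lemma conj_lfun_mul g h L : g \in unitmx -> h \in unitmx ->
  (conj_lfun (h *m g) @: L = conj_lfun h @: (conj_lfun g @: L))%VS.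
Proof.
move=> gu hu; rewrite -limg_comp; congr (_ @: _)%VS.
by apply/lfunP => X; rewrite comp_lfunE !conj_lfunE invmx_mul // !mulmxA.
Qed.

Definition torus_grp (s1 s2 : F) : 'M[F]_4 :=
  mx4 (tab [:: [:: s1; 0; 0; 0]; [:: 0; s2; 0; 0];
               [:: 0; 0; s1^-1; 0]; [:: 0; 0; 0; s2^-1]]).

Lemma torus_grp_Sp4 s1 s2 : s1 != 0 -> s2 != 0 -> in_Sp4 (torus_grp s1 s2).
Proof.
move=> s10 s20; apply: in_Sp4I.
by rewrite sp4_JE mx4T !mx4M; mx4_entries; field; rewrite ?s10 ?s20.
Qed.

Lemma torus_grp_conj s1 s2 a b x y z t : s1 != 0 -> s2 != 0 ->
  conj_lfun (torus_grp s1 s2) (borel a b x y z t) =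
  borel a b (s2 ^+ 2 * x) (s1 / s2 * y) (s1 * s2 * z) (s1 ^+ 2 * t).
Proof.
move=> s10 s20; have [hu _] := torus_grp_Sp4 s10 s20.
rewrite conj_lfunE; apply: (canLR (mulmxK hu)).
by rewrite !mx4M; mx4_entries; field; rewrite ?s10 ?s20.
Qed.

Lemma dim_alg_T11 : (\dim (alg_T11 F) <= 4)%N.
Proof. exact: dim_span. Qed.

Lemma dim_alg_T10 : (\dim (alg_T10 F) <= 4)%N.
Proof. exact: dim_span. Qed.

Lemma mem_alg_T11 (c x z t : F) : borel c c x c z t \in alg_T11 F.
Proof.
have -> : borel c c x c z t = c *: (torus_elt 1 1 + X_beta F) + x *: X_alpha F +
    z *: X_alpha_beta F + t *: X_alpha_2beta F.
  rewrite torus_eltE X_alphaE X_betaE X_alpha_betaE X_alpha_2betaE.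
  rewrite borelD !borelZ !borelD; congr borel; ring.
by rewrite !memvD // memvZ // memv_span // !inE eqxx ?orbT.
Qed.

Lemma mem_alg_T10 (c y z t : F) : borel c 0 c y z t \in alg_T10 F.
Proof.
have -> : borel c 0 c y z t = c *: (torus_elt 1 0 + X_alpha F) + y *: X_beta F +
    z *: X_alpha_beta F + t *: X_alpha_2beta F.
  rewrite torus_eltE X_alphaE X_betaE X_alpha_betaE X_alpha_2betaE.
  rewrite borelD !borelZ !borelD; congr borel; ring.
by rewrite !memvD // memvZ // memv_span // !inE eqxx ?orbT.
Qed.

Lemma span4P (v1 v2 v3 v4 : 'M[F]_4) X : X \in <<[:: v1; v2; v3; v4]>>%VS ->
  exists c1 c2 c3 c4, X = c1 *: v1 + c2 *: v2 + c3 *: v3 + c4 *: v4.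
Proof.
rewrite !span_cons span_nil addv0.
move=> /memv_addP[_ /vlineP[c1 ->] [r /memv_addP[_ /vlineP[c2 ->] [s sv ->]] ->]].
have /memv_addP[_ /vlineP[c3 ->] [_ /vlineP[c4 ->] ->]] := sv.
by exists c1, c2, c3, c4; rewrite !addrA.
Qed.

Lemma mem_alg_T11E X : X \in alg_T11 F ->
  exists c x z t, X = borel c c x c z t.
Proof.
move=> /span4P[c [x [z [t ->]]]]; exists c, x, z, t.
rewrite torus_eltE X_alphaE X_betaE X_alpha_betaE X_alpha_2betaE.
by rewrite borelD !borelZ !borelD; congr borel; ring.
Qed.

(** Used with U = L: once one root vector is missing from L, any other one lies in L up to a
    multiple of it. *)
Lemma corank1_subv (V : vectType F) (U W : {vspace V}) v w :
  (U <= W)%VS -> (\dim W <= (\dim U).+1)%N -> v \in W -> v \notin U -> w \in W ->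
  exists k, w - k *: v \in U.
Proof.
move=> UW dimW vW vU wW.
have : (U + <[v]> == W)%VS.
  rewrite eqEdim subv_add UW -memvE vW /=; apply: leq_trans dimW _.
  rewrite dimv_disjoint_sum ?dim_vline; last first.
    apply/eqP; rewrite -subv0; apply/subvP => x; rewrite memv_cap.
    move=> /andP[xU /vlineP[k xk]]; rewrite memv0 xk.
    have [->|k0] := eqVneq k 0; first by rewrite scale0r.
    by case/negP: vU; rewrite -(scalerK k0 v) -xk memvZ.
  rewrite addnC; case: eqP vU => // ->; by rewrite mem0v.
move=> /eqP UvW; move: wW; rewrite -UvW => /memv_addP[u uU [_ /vlineP[k ->] ->]].
by exists k; rewrite addrK.
Qed.

End Conjugation.

(** * Semisimple and nilpotent Borel elements *)

Section Semisimple.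
Variable C : numClosedFieldType.

(** By [borel_char_poly] the minimal polynomial divides a product of distinct linear factors. *)
Lemma regular_semisimple (a b x y z t : C) :
  uniq [:: a; b; - b; - a] -> semisimple_mx (borel a b x y z t).
Proof.
move=> ab_uniq; apply/mxred.diagonalizableP; exists [:: a; b; - b; - a] => //.
apply: mxminpoly_min; rewrite !big_cons big_nil mulr1 !polyCN !opprK.
rewrite !rmorphM /= !rmorphB !rmorphD /= !horner_mx_X !horner_mx_C.
by rewrite -!mulmxE !mulmxA borel_char_poly.
Qed.

Lemma similar_torus_semisimple (P A : 'M[C]_4) (a b : C) : P \in unitmx ->
  P *m A = torus_elt a b *m P -> semisimple_mx A.
Proof.
move=> Pu PA; exists P => //; rewrite /similar_to conjumx // PA mulmxK //.
exact: diag_mx_is_diag.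
Qed.

(** As [T, X_beta] = (a - b) X_beta, conjugation by exp(s X_beta) = 1 + s X_beta with s = y / (a -
    b) removes the root part. The next lemma does the same for alpha, of weight 2b. *)
Lemma borel_beta_semisimple (a b y : C) :
  a != b -> semisimple_mx (borel a b 0 y 0 0).
Proof.
rewrite -subr_eq0 => ab; pose u s := 1%:M + borel 0 0 0 s 0 0 : 'M[C]_4.
have [Pu _] : u (y / (a - b)) \in unitmx /\ u (- (y / (a - b))) \in unitmx.
  apply: mulmx1_unit; rewrite /u mx4C !mx4D mx4M; mx4_entries; ring.
apply: (similar_torus_semisimple (a := a) (b := b) Pu).
rewrite torus_eltE /u mx4C !mx4D !mx4M; mx4_entries; by field.
Qed.

Lemma borel_alpha_semisimple (a b x : C) :
  b != 0 -> semisimple_mx (borel a b x 0 0 0).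
Proof.
move=> b0; pose u s := 1%:M + borel 0 0 s 0 0 0 : 'M[C]_4.
have [Pu _] : u (x / (2 * b)) \in unitmx /\ u (- (x / (2 * b))) \in unitmx.
  apply: mulmx1_unit; rewrite /u mx4C !mx4D mx4M; mx4_entries; ring.
apply: (similar_torus_semisimple (a := a) (b := b) Pu).
rewrite torus_eltE /u mx4C !mx4D !mx4M; mx4_entries; by field.
Qed.

Lemma borel_nilpotent (x y z t : C) : nilpotent_mx (borel 0 0 x y z t).
Proof.
exists 4%N; have := borel_char_poly 0 0 x y z t.
by rewrite /= raddf0 subr0 addr0 !mulmxE !exprS expr0 mulr1 !mulrA.
Qed.

Lemma semisimple_conj (g X : 'M[C]_4) : g \in unitmx ->
  semisimple_mx (g *m X *m invmx g) -> semisimple_mx X.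
Proof.
move=> gu [P Pu dP]; exists (P *m g); first by rewrite unitmx_mul Pu.
move: dP; rewrite /similar_to !conjumx ?unitmx_mul ?Pu // invmx_mul //.
by rewrite !mulmxA.
Qed.

Lemma nilpotent_conj (g X : 'M[C]_4) : g \in unitmx ->
  nilpotent_mx X -> nilpotent_mx (g *m X *m invmx g).
Proof.
move=> gu [k Xk]; exists k.
suff -> : (g *m X *m invmx g) ^+ k = g *m X ^+ k *m invmx g.
  by rewrite Xk mulmx0 mul0mx.
elim: k {Xk} => [|k IHk]; first by rewrite !expr0 mulmx1 mulmxV.
by rewrite !exprS IHk -!mulmxE !mulmxA mulmxKV.
Qed.

Lemma conj_lie_bracket (g X Y : 'M[C]_4) : g \in unitmx ->
  lie_bracket (g *m X *m invmx g) (g *m Y *m invmx g) =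
  g *m lie_bracket X Y *m invmx g.
Proof.
by move=> gu; rewrite /lie_bracket mulmxBr mulmxBl !mulmxA !mulmxKV.
Qed.

End Semisimple.

(** * Classification inside the Borel subalgebra *)

Section Classification.
Variable C : numClosedFieldType.
Variable L : {vspace 'M[C]_4}.
Hypothesis L_lie : forall X Y, X \in L -> Y \in L -> lie_bracket X Y \in L.
Hypothesis L_dim : \dim L = 4%N.
Hypothesis L_ss : forall X, X \in L -> semisimple_mx X -> X = 0.
Hypothesis L_borel : forall X, X \in L ->
  exists a b x y z t, X = borel a b x y z t.

Lemma borel_eq0 (a b x y z t : C) : borel a b x y z t = 0 -> a = 0 /\ b = 0.
Proof.
have -> : 0 = mx4 (fun _ _ => 0) :> 'M[C]_4 by apply/matrixP => i j; rewrite !mxE.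
move=> /eq_mx4 e; split; first by have := e 0%N 0%N isT isT.
by have := e 1%N 1%N isT isT.
Qed.

Lemma not_regular (a b x y z t : C) : borel a b x y z t \in L ->
  ~~ uniq [:: a; b; - b; - a].
Proof.
move=> XL; apply/negP => ab.
have [a0 b0] := borel_eq0 (L_ss XL (regular_semisimple _ _ _ _ ab)).
by move: ab; rewrite a0 b0 /= !inE eqxx.
Qed.

Lemma regular_natmul (n : nat) (b : C) : (1 < n)%N -> b != 0 ->
  uniq [:: n%:R * b; b; - b; - (n%:R * b)].
Proof.
move=> n1 b0.
have neq (c d : C) (k : nat) : (0 < k)%N -> c - d = k%:R * b -> c != d.
  by move=> k0 cd; rewrite -subr_eq0 cd mulf_neq0 // pnatr_eq0 -lt0n.
have n1E : n.-1%:R = n%:R - 1 :> C by rewrite -subn1 natrB // ltnW.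
have nb : n%:R * b != b.
  by apply: (neq _ _ n.-1); [case: (n) n1 => [|[]] | rewrite n1E; ring].
have nNb : n%:R * b != - b by apply: (neq _ _ n.+1) => //; ring.
have bNb : b != - b by apply: (neq _ _ 2%N) => //; ring.
have nNn : n%:R * b != - (n%:R * b).
  by apply: (neq _ _ (n + n)%N); [rewrite addn_gt0 ltnW | ring].
have bNn : b != - (n%:R * b) by rewrite eq_sym eqr_oppLR.
by rewrite /= !inE !negb_or nb nNb nNn bNb bNn eqr_opp eq_sym nb.
Qed.

(** Two independent torus parts would combine, by Cramer's rule, to the regular T_(2,1). *)
Lemma torus_part_collinear (a b x y z t a' b' x' y' z' t' : C) :
  borel a b x y z t \in L -> borel a' b' x' y' z' t' \in L -> a * b' = a' * b.
Proof.
move=> XL YL; apply/eqP; rewrite -subr_eq0; apply/negP => /negP d0.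
set d := a * b' - a' * b in d0.
have := memvD (memvZ ((2 * b' - a') / d) XL) (memvZ ((a - 2 * b) / d) YL).
rewrite !borelZ borelD => /not_regular.
have -> : (2 * b' - a') / d * a + (a - 2 * b) / d * a' = 2%:R * 1.
  by rewrite /d; field.
have -> : (2 * b' - a') / d * b + (a - 2 * b) / d * b' = 1 by rewrite /d; field.
by rewrite regular_natmul ?oner_neq0.
Qed.

Lemma borel_classification X0 : X0 \in L -> ~ nilpotent_mx X0 ->
  Sp4_conjugate L (alg_T11 C) \/ Sp4_conjugate L (alg_T10 C).
Proof.
move=> X0L; have [a [b [x [y [z [t X0E]]]]]] := L_borel X0L.
move=> X0_nil; have ab0 : (a != 0) || (b != 0).
  rewrite -negb_and; apply/negP => /andP[/eqP a0 /eqP b0].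
  by apply: X0_nil; rewrite X0E a0 b0; apply: borel_nilpotent.
have LE X : X \in L -> exists k x' y' z' t',
    X = borel (k * a) (k * b) x' y' z' t'.
  move=> XL; have [a' [b' [x' [y' [z' [t' XE]]]]]] := L_borel XL.
  rewrite XE X0E in XL X0L *; have abE := torus_part_collinear X0L XL.
  case/orP: ab0 => [a0|b0].
    exists (a' / a), x', y', z', t'; congr borel; first by field.
    by apply: (mulfI a0); rewrite abE; field.
  exists (b' / b), x', y', z', t'; congr borel; last by field.
  by apply: (mulIf b0); rewrite -abE; field.
pose e x y z t : 'M[C]_4 := borel 0 0 x y z t.
(* W contains L and has dimension at most 5, so L has corank at most one in it. *)
pose W := span [:: X0; e 1 0 0 0; e 0 1 0 0; e 0 0 1 0; e 0 0 0 1].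
have eE x' y' z' t' : e x' y' z' t' = x' *: e 1 0 0 0 + y' *: e 0 1 0 0 +
    z' *: e 0 0 1 0 + t' *: e 0 0 0 1.
  by rewrite /e !borelZ !borelD; congr borel; ring.
have eW x' y' z' t' : e x' y' z' t' \in W.
  by rewrite eE !memvD // memvZ // memv_span // !inE eqxx ?orbT.
have LW : (L <= W)%VS.
  apply/subvP => X /LE[k [x' [y' [z' [t' ->]]]]].
  have -> : borel (k * a) (k * b) x' y' z' t' =
      k *: X0 + e (x' - k * x) (y' - k * y) (z' - k * z) (t' - k * t).
    by rewrite X0E borelZ /e borelD; congr borel; ring.
  by rewrite memvD // memvZ // memv_span // inE eqxx.
have dimW : (\dim W <= (\dim L).+1)%N by rewrite L_dim; apply: dim_span.
have lift v w : v \in W -> v \notin L -> w \in W -> exists k, w - k *: v \in L.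
  exact: corank1_subv LW dimW.
(* Otherwise the lifts of X_beta and X_(alpha+beta) bracket to 2 X_(alpha+2beta). *)
have e4L : e 0 0 0 1 \in L.
  apply/negPn/negP => e4L.
  have [k1 e2L] := lift _ _ (eW _ _ _ _) e4L (eW 0 1 0 0).
  have [k2 e3L] := lift _ _ (eW _ _ _ _) e4L (eW 0 0 1 0).
  have := L_lie e2L e3L; rewrite -!scaleNr /e !borelZ !borelD borel_bracket.
  move=> /(memvZ (2^-1)); rewrite borelZ => e4L'; case/negP: e4L.
  by apply: etrans e4L'; congr (_ \in L); rewrite /e; congr borel; field.
(* Otherwise the lifts of X_alpha and X_beta bracket to -X_(alpha+beta) plus a multiple of
   X_(alpha+2beta), already in L. *)
have e3L : e 0 0 1 0 \in L.
  apply/negPn/negP => e3L.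
  have [k1 e1L] := lift _ _ (eW _ _ _ _) e3L (eW 1 0 0 0).
  have [k2 e2L] := lift _ _ (eW _ _ _ _) e3L (eW 0 1 0 0).
  have := L_lie e1L e2L; rewrite -!scaleNr /e !borelZ !borelD borel_bracket.
  move=> e3L'; case/negP: e3L.
  have := memvD (memvZ (-1) e3L') (memvZ (2 * k1) e4L).
  rewrite !borelZ borelD => {}e3L'.
  by apply: etrans e3L'; congr (_ \in L); rewrite /e; congr borel; ring.
have torus0 : borel a b 0 0 0 0 \notin L.
  apply/negP => TL; have [a0 b0] : a = 0 /\ b = 0.
    by apply: (@borel_eq0 a b 0 0 0 0); apply: L_ss => //;
      rewrite -torus_eltE; apply: mxred.diagonalizable_diag.
  by move: ab0; rewrite a0 b0 eqxx.
have concl h A : in_Sp4 h -> (\dim A <= 4)%N ->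
    (forall X, X \in L -> conj_lfun h X \in A) ->
    Sp4_conjugate L A.
  move=> hSp dimA hLA; exists h; split=> //; apply/eqP; rewrite eqEdim.
  rewrite dim_conj_lfun ?L_dim ?dimA ?andbT; last by case: hSp.
  by apply/subvP => _ /memv_imgP[X XL ->]; apply: hLA.
have [e1L|e1L] := boolP (e 1 0 0 0 \in L).
  left; have XyL : borel a b 0 y 0 0 \in L.
    have -> : borel a b 0 y 0 0 =
        X0 - (x *: e 1 0 0 0 + z *: e 0 0 1 0 + t *: e 0 0 0 1).
      by rewrite X0E -scaleN1r /e !borelZ !borelD borelZ borelD; congr borel; ring.
    by rewrite rpredB // !memvD // memvZ.
  have eq_ab : a = b.
    apply: contraNeq torus0 => nab; exfalso; move: ab0.
    have [-> ->] := borel_eq0 (L_ss XyL (borel_beta_semisimple _ nab)).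
    by rewrite eqxx.
  rewrite -eq_ab orbb in ab0; rewrite -eq_ab in XyL torus0 LE.
  have y0 : y != 0 by apply: contraNneq torus0 => y0;
    rewrite -[X in borel _ _ _ X]y0.
  have e2L : e 0 1 0 0 \notin L.
    apply: contra torus0 => e2L.
    have -> : borel a a 0 0 0 0 = borel a a 0 y 0 0 - y *: e 0 1 0 0.
      by rewrite -scaleN1r /e !borelZ borelD; congr borel; ring.
    by rewrite rpredB // memvZ.
  (* Conjugation by [torus_grp (a / y) 1] multiplies the X_beta coefficient by a / y, making it
     equal to the torus coefficient. *)
  have s0 : a / y != 0 by rewrite mulf_neq0 ?invr_neq0.
  apply: (concl _ _ (torus_grp_Sp4 s0 (oner_neq0 _)) (dim_alg_T11 _)) => X XL.
  have [k [x' [y' [z' [t' XE]]]]] := LE X XL.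
  (* Otherwise subtracting known elements of L from X isolates a nonzero multiple of X_beta. *)
  have y'E : y' = k * y.
    apply/eqP; rewrite -subr_eq0; apply: contraNT e2L => yk.
    have -> : e 0 1 0 0 = (y' - k * y)^-1 *: (X - (k *: borel a a 0 y 0 0 +
        x' *: e 1 0 0 0 + z' *: e 0 0 1 0 + t' *: e 0 0 0 1)).
      rewrite XE -scaleN1r /e !borelZ !borelD !borelZ !borelD borelZ.
      by congr borel; field.
    by rewrite memvZ // rpredB // !memvD // memvZ.
  rewrite XE y'E torus_grp_conj ?oner_neq0 //.
  have -> : a / y / 1 * (k * y) = k * a by field.
  exact: mem_alg_T11.
right; have [k e12L] := lift _ _ (eW _ _ _ _) e1L (eW 0 1 0 0).
(* X0 acts on X_alpha and X_beta with weights 2b and a - b modulo the other two root vectors.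
   Bracketing X_beta - k X_alpha with X0 thus isolates k (a - 3b) X_alpha, and a = 3b is excluded as
   regular. *)
have k0 : k = 0.
  apply/eqP; apply: contraNT e1L => k0.
  have [a3b|a3b] := eqVneq a (3%:R * b).
    exfalso; have b0 : b != 0.
      by apply: contraTneq ab0 => b0; rewrite a3b b0 mulr0 eqxx.
    by move: X0L; rewrite X0E => /not_regular; rewrite a3b regular_natmul.
  have d0 : k * (a - 3%:R * b) != 0 by rewrite mulf_neq0 ?subr_eq0.
  have -> : e 1 0 0 0 = (k * (a - 3%:R * b))^-1 *:
      (lie_bracket X0 (e 0 1 0 0 - k *: e 1 0 0 0) -
       ((a - b) *: (e 0 1 0 0 - k *: e 1 0 0 0) + (- k * y - x) *: e 0 0 1 0 +
        (- 2%:R * z) *: e 0 0 0 1)).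
    rewrite X0E -!scaleNr -!scaleN1r /e !borelZ !borelD borel_bracket.
    rewrite !borelZ !borelD !borelZ !borelD !borelZ.
    by congr borel; field; rewrite subr_eq0 a3b k0.
  by rewrite memvZ // rpredB ?L_lie // !memvD // memvZ.
have e2L : e 0 1 0 0 \in L by rewrite k0 scale0r subr0 in e12L.
have XxL : borel a b x 0 0 0 \in L.
  have -> : borel a b x 0 0 0 =
      X0 - (y *: e 0 1 0 0 + z *: e 0 0 1 0 + t *: e 0 0 0 1).
    by rewrite X0E -scaleN1r /e !borelZ !borelD borelZ borelD; congr borel; ring.
  by rewrite rpredB // !memvD // memvZ.
have b0 : b = 0.
  apply: contraNeq torus0 => b0; exfalso; move: ab0.
  have [-> ->] := borel_eq0 (L_ss XxL (borel_alpha_semisimple _ _ b0)).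
  by rewrite eqxx.
rewrite b0 eqxx orbF in ab0; rewrite b0 in XxL torus0 LE.
have x0 : x != 0 by apply: contraNneq torus0 => x0; rewrite -[X in borel _ _ X]x0.
(* The torus scales the X_alpha coefficient by a square, hence the root. *)
pose s := sqrtC (a / x).
have s2 : s ^+ 2 = a / x by apply: sqrtCK.
have s0 : s != 0 by rewrite sqrtC_eq0 mulf_neq0 ?invr_neq0.
apply: (concl _ _ (torus_grp_Sp4 (oner_neq0 _) s0) (dim_alg_T10 _)) => X XL.
have [c [x' [y' [z' [t' XE]]]]] := LE X XL.
have x'E : x' = c * x.
  apply/eqP; rewrite -subr_eq0; apply: contraNT e1L => xc.
  have -> : e 1 0 0 0 = (x' - c * x)^-1 *: (X - (c *: borel a 0 x 0 0 0 +
      y' *: e 0 1 0 0 + z' *: e 0 0 1 0 + t' *: e 0 0 0 1)).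
    rewrite XE -scaleN1r /e !borelZ !borelD !borelZ !borelD borelZ.
    by congr borel; field.
  by rewrite memvZ // rpredB // !memvD // memvZ.
rewrite XE x'E torus_grp_conj ?oner_neq0 // s2 mulr0.
have -> : a / x * (c * x) = c * a by field.
exact: mem_alg_T10.
Qed.

End Classification.

(** * The two algebras are not conjugate *)

Section Inequivalence.
Variable F : fieldType.

(* An element of the first algebra has a single eigenvalue up to sign, whereas
   T_(1,0) + X_alpha has the eigenvalues 0 and 1. *)
Lemma alg_T11_T10_not_conjugate : ~ Sp4_conjugate (alg_T11 F) (alg_T10 F).
Proof.
move=> [g [[gu _] gA]].
have : borel 1 0 1 0 0 0 \in alg_T10 F by exact: mem_alg_T10.
rewrite -gA => /memv_imgP[X /mem_alg_T11E[c [x [z [t ->]]]]]; rewrite conj_lfunE.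
set X' := borel c _ _ _ _ _; set Y := borel 1 _ _ _ _ _ => YE.
have Yg d : (Y - d%:M) *m g = g *m (X' - d%:M).
  by rewrite mulmxBl mulmxBr YE mulmxKV // scalar_mxC.
have YgN d : (Y + d%:M) *m g = g *m (X' + d%:M).
  by rewrite mulmxDl mulmxDr YE mulmxKV // scalar_mxC.
(* The polynomial kills X' by [borel_char_poly], hence also its conjugate Y. *)
have : (Y - c%:M) *m (Y - c%:M) *m (Y + c%:M) *m (Y + c%:M) *m g = 0.
  rewrite -!mulmxA YgN (mulmxA _ g) YgN -(mulmxA g) (mulmxA _ g) Yg.
  rewrite -(mulmxA g) (mulmxA _ g) Yg -(mulmxA g) -[RHS](mulmx0 _ g).
  by congr (_ *m _); rewrite !mulmxA borel_char_poly.
move=> /(congr1 (mulmxr (invmx g))) /=; rewrite mulmxK // mul0mx.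
have -> : 0 = mx4 (fun _ _ => 0) :> 'M[F]_4 by apply/matrixP => i j; rewrite !mxE.
rewrite mx4C !mx4N !mx4D !mx4M => /eq_mx4 Y0.
(* The last diagonal entry gives c = 0, after which the first reads 1 = 0. *)
have := Y0 3%N 3%N isT isT; have := Y0 0%N 0%N isT isT.
rewrite /tab /= !(oppr0, mul0r, mulr0, addr0, add0r, mulr1n, mulr0n).
move=> Y00 /eqP; rewrite !mulf_eq0 oppr_eq0 !orbb => /eqP c0.
by move: Y00; rewrite c0 subr0 addr0 !mul1r => /eqP; rewrite oner_eq0.
Qed.

End Inequivalence.

(** * Transport to the Borel subalgebra and back *)

Theorem theorem8p5 (R : realType) :
  (forall L : {vspace 'M[R[i]]_4},
     sp4_subalgebra L ->
     \dim L = 4%N ->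
     lie_solvable L ->
     (forall X, X \in L -> semisimple_mx X -> X = 0) ->
     ~ (forall X, X \in L -> nilpotent_mx X) ->
     Sp4_conjugate L (alg_T11 R[i]) \/ Sp4_conjugate L (alg_T10 R[i])) /\
  ~ Sp4_conjugate (alg_T11 R[i]) (alg_T10 R[i]).
Proof.
split=> [L L_alg L_dim L_solv L_ss L_nil|]; last exact: alg_T11_T10_not_conjugate.
have [g gSp gL] := in_borel_conj L_alg L_solv.
have [[_ L_lie] [gu _]] := (L_alg, gSp).
pose L' := (conj_lfun g @: L)%VS.
have L'P X : X \in L' -> exists2 Y, Y \in L & X = g *m Y *m invmx g.
  by move=> /memv_imgP[Y YL ->]; exists Y; rewrite ?conj_lfunE.
have L'I X : X \in L -> g *m X *m invmx g \in L'.
  by move=> XL; rewrite -conj_lfunE memv_img.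
have [X0 [X0L X0_nil]] : exists X0, X0 \in L' /\ ~ nilpotent_mx X0.
  move/existsNP: L_nil => [X /not_implyP[XL X_nil]].
  exists (g *m X *m invmx g); split; first exact: L'I.
  move=> /(nilpotent_conj (g := invmx g)); rewrite unitmx_inv invmxK => /(_ gu).
  by rewrite !mulmxA mulVmx // mul1mx mulmxKV.
have trans A : Sp4_conjugate L' A -> Sp4_conjugate L A.
  move=> [h [hSp hA]]; exists (h *m g); split; first exact: in_Sp4_mul.
  by rewrite conj_lfun_mul //; case: hSp.
have [||||hA|hA] := @borel_classification _ L' _ _ _ _ _ X0L X0_nil.
- by move=> _ _ /L'P[X XL ->] /L'P[Y YL ->];
     rewrite conj_lie_bracket // L'I // L_lie.
- by rewrite dim_conj_lfun.
- move=> _ /L'P[X XL ->] /(semisimple_conj gu)/(L_ss _ XL) ->.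
  by rewrite mulmx0 mul0mx.
- by move=> _ /L'P[X XL ->]; apply: gL.
- by left; apply: trans.
- by right; apply: trans.
Qed.
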